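(* Let $\bar M=I_f\times M$ be a standard static space-time with the metric $\bar g=-f^2\,dt^2\oplus g$. Suppose that $u:I\to\mathbb{R}$ is smooth on $I$ and let $\zeta\in\mathfrak{X}(M)$. Then $\bar\zeta=u\partial_t+\zeta$ is a $2$-Killing vector field on $\bar M$ if one of the following conditions is satisfied: (1) $\zeta$ is $2$-Killing on $M$, $u=a$ and $f\zeta(f)=b$, where $a,b\in\mathbb{R}$. (2) $\zeta$ is $2$-Killing on $M$, $u=(rt+s)^{\frac13}$ and $\zeta(f)=0$, where $r,s\in\mathbb{R}$.
   Context: Let $(M,g)$ be an $n$-dimensional Riemannian manifold, $f:M\to(0,\infty)$ a smooth function, and $I$ an open connected subinterval of $\mathbb{R}$ with coordinate $t$ and Euclidean metric $dt^2$. The standard static space-time $\bar M=I_f\times M$ is the $(n+1)$-dimensional product manifold $I\times M$ furnished with the metric tensor $\bar g=-f^2\,dt^2\oplus g$. $\mathfrak{X}(M)$ denotes the smooth vector fields on $M$; the same notation is used for vector fields on $I$ or $M$ and their lifts to $I\times M$. A vector field $\zeta$ on a pseudo-Riemannian manifold with metric $g$ is $2$-Killing if $\mathcal{L}_\zeta\mathcal{L}_\zeta g=0$, where $\mathcal{L}_\zeta$ is the Lie derivative. $\zeta(f)$ is the derivative of $f$ in the direction $\zeta$. *)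

(* Defs.v *)
From HB Require Import structures.
From mathcomp Require Import all_boot all_order all_algebra.
From mathcomp Require Import all_classical all_reals all_analysis.
From mathcomp Require Import ring.
Set Implicit Arguments.
Unset Strict Implicit.
Unset Printing Implicit Defensive.
Import Order.TTheory GRing.Theory Num.Theory.
Import numFieldNormedType.Exports.
Local Open Scope classical_set_scope.
Local Open Scope ring_scope.

Definition partial (R : realType) (n : nat) (k : 'I_n) (h : 'rV[R]_n -> R) :
  'rV[R]_n -> R := fun x => 'D_(delta_mx 0 k) h x.

(* [U] is always an open set below.  [Cdiff m] means m times (Frechet)
   differentiable, so that being [Cdiff m] for all m is being C^oo. *)
Fixpoint Cdiff (R : realType) (n m : nat) (U : set 'rV[R]_n)
    (h : 'rV[R]_n -> R) : Prop :=
  if m is m'.+1 then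
    (forall x, U x -> differentiable h x) /\
    (forall k : 'I_n, Cdiff m' U (partial k h))
  else True.

Definition smooth_on (R : realType) (n : nat) (U : set 'rV[R]_n)
  (h : 'rV[R]_n -> R) : Prop := forall m, Cdiff m U h.

Definition smooth_on_line (R : realType) (I : set R) (u : R -> R) : Prop :=
  forall (m : nat) (t : R), I t -> derivable (derive1n m u) t 1.

(* An indexed family of R^n-valued charts; [coord i] is meaningful on [dom i]
   only.  The atlas need not be maximal. *)
Record atlas (R : realType) (T : topologicalType) (n : nat) := Atlas {
  idx : Type;
  dom : idx -> set T;
  coord : idx -> T -> 'rV[R]_n }.

Section Charts.
Context {R : realType} {T : topologicalType} {n : nat} (A : atlas R T n).
Implicit Types (i j : idx A) (p : T).

(* h \o (coord i)^-1 on [coord i @` dom i], and 0 elsewhere. *)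
Definition read i (h : T -> R) : 'rV[R]_n -> R :=
  fun x => xget 0 [set h p | p in dom i `&` coord i @^-1` [set x]].

(* dh/dx^k for the coordinates x^0, .., x^(n-1) of the chart i. *)
Definition pd i (k : 'I_n) (h : T -> R) : T -> R :=
  fun p => partial k (read i h) (coord i p).

Definition jac i j p : 'M[R]_n :=
  \matrix_(k, l) pd i k (fun q => coord j q 0 l) p.

Definition smooth_manifold : Prop :=
  [/\ hausdorff_space T, @second_countable T,
      forall p, exists i, dom i p,
      forall i, [/\ open (dom i),
                    {in dom i &, injective (coord i)},
                    (forall p, dom i p -> {for p, continuous (coord i)}) &
                    (forall V, open V -> V `<=` dom i ->
                       open (coord i @` V))] &
      forall i j (l : 'I_n),
        smooth_on (coord i @` (dom i `&` dom j))
                  (read i (fun q => coord j q 0 l))].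

Definition smooth_in_chart i (h : T -> R) : Prop :=
  smooth_on (coord i @` dom i) (read i h).

Definition smooth_function (h : T -> R) : Prop :=
  forall i, smooth_in_chart i h.

(* A tensor field is the family of its components in the charts of the atlas,
   subject to smoothness and to the transformation law.  A vector field X is
   given by rows, X = sum_k (X i p 0 k) d/dx^k in the chart i, and a covariant
   2-tensor field g by matrices, (g i p k l) = g (d/dx^k, d/dx^l). *)
Definition vector_field (X : idx A -> T -> 'rV[R]_n) : Prop :=
  (forall i k, smooth_in_chart i (fun p => X i p 0 k)) /\
  (forall i j p, dom i p -> dom j p -> X j p = X i p *m jac i j p).

Definition tensor02 (g : idx A -> T -> 'M[R]_n) : Prop :=
  (forall i k l, smooth_in_chart i (fun p => g i p k l)) /\
  (forall i j p, dom i p -> dom j p ->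
     g i p = jac i j p *m g j p *m (jac i j p)^T).

Definition riemannian_metric (g : idx A -> T -> 'M[R]_n) : Prop :=
  [/\ tensor02 g,
      forall i p, dom i p -> (g i p)^T = g i p &
      forall i p, dom i p -> forall v : 'rV[R]_n, v != 0 ->
        0 < (v *m g i p *m v^T) 0 0].

(* X(h) on the domain of the chart i; for a vector field X it does not depend
   on i. *)
Definition dir_deriv (X : idx A -> T -> 'rV[R]_n) i (h : T -> R) : T -> R :=
  fun p => \sum_(k < n) X i p 0 k * pd i k h p.

(* (L_X g)_ab = X^k d_k g_ab + g_kb d_a X^k + g_ak d_b X^k. *)
Definition lie (X : idx A -> T -> 'rV[R]_n) (g : idx A -> T -> 'M[R]_n) :
    idx A -> T -> 'M[R]_n :=
  fun i p => \matrix_(a, b)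
    (dir_deriv X i (fun q => g i q a b) p
     + \sum_(k < n) g i p k b * pd i a (fun q => X i q 0 k) p
     + \sum_(k < n) g i p a k * pd i b (fun q => X i q 0 k) p).

Definition two_killing (g : idx A -> T -> 'M[R]_n)
    (X : idx A -> T -> 'rV[R]_n) : Prop :=
  vector_field X /\ forall i p, dom i p -> lie X (lie X g) i p = 0.

Definition bracket (X Y : idx A -> T -> 'rV[R]_n) : idx A -> T -> 'rV[R]_n :=
  fun i p => \row_k (dir_deriv X i (fun q => Y i q 0 k) p
                     - dir_deriv Y i (fun q => X i q 0 k) p).

Definition tensor_eval (g : idx A -> T -> 'M[R]_n)
    (X Y : idx A -> T -> 'rV[R]_n) (i : idx A) : T -> R :=
  fun p => \sum_(a < n) \sum_(b < n) g i p a b * (X i p 0 a * Y i p 0 b).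

Lemma readE i h p : {in dom i &, injective (coord i)} -> dom i p ->
  read i h (coord i p) = h p.
Proof.
move=> inj ip; rewrite /read; apply: xget_unique; first by exists p.
by move=> _ [q [iq /= eqp] <-]; congr h; apply: inj => //; rewrite inE.
Qed.

Lemma read_out i h x : ~ (coord i @` dom i) x -> read i h x = 0.
Proof.
move=> Nx; rewrite /read; case: xgetP => // y _ [q [iq /= qx] _].
by case: Nx; exists q.
Qed.

Lemma readD i h1 h2 : {in dom i &, injective (coord i)} ->
  read i (fun p => h1 p + h2 p) = read i h1 + read i h2.
Proof.
move=> inj; apply/funext => x; rewrite fctE.
have [[q iq <-]|Nx] := pselect ((coord i @` dom i) x); first by rewrite !readE.
by rewrite !read_out// addr0.
Qed.

Lemma readM i h1 h2 : {in dom i &, injective (coord i)} ->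
  read i (fun p => h1 p * h2 p) = read i h1 * read i h2.
Proof.
move=> inj; apply/funext => x; rewrite fctE.
have [[q iq <-]|Nx] := pselect ((coord i @` dom i) x); first by rewrite !readE.
by rewrite !read_out// mulr0.
Qed.

Definition diff_in_chart i p (h : T -> R) : Prop :=
  differentiable (read i h) (coord i p).

Lemma diffM i p h1 h2 : {in dom i &, injective (coord i)} ->
  diff_in_chart i p h1 -> diff_in_chart i p h2 ->
  diff_in_chart i p (fun q => h1 q * h2 q).
Proof.
by move=> inj d1 d2; rewrite /diff_in_chart readM//; exact: differentiableM.
Qed.

Lemma pdM i p k h1 h2 : {in dom i &, injective (coord i)} -> dom i p ->
  diff_in_chart i p h1 -> diff_in_chart i p h2 ->
  pd i k (fun q => h1 q * h2 q) p = h1 p * pd i k h2 p + h2 p * pd i k h1 p.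
Proof.
move=> inj ip d1 d2; rewrite /pd /partial readM// deriveM; last 2 first.
- exact: diff_derivable.
- exact: diff_derivable.
by rewrite !readE.
Qed.

Lemma diff_pd_sum i p m (h : 'I_m -> T -> R) :
  {in dom i &, injective (coord i)} -> dom i p ->
  (forall a, diff_in_chart i p (h a)) ->
  diff_in_chart i p (fun q => \sum_(a < m) h a q) /\
  forall k, pd i k (fun q => \sum_(a < m) h a q) p = \sum_(a < m) pd i k (h a) p.
Proof.
move=> inj ip; elim: m h => [|m IH] h dh.
  have e : read i (fun q => \sum_(a < 0) h a q) = cst 0.
    apply/funext => x.
    have [[q iq <-]|Nx] := pselect ((coord i @` dom i) x).
      by rewrite readE// big_ord0.
    by rewrite read_out.
  split=> [|k]; first by rewrite /diff_in_chart e; exact: differentiable_cst.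
  by rewrite /pd /partial e derive_cst big_ord0.
have [d1 d2] := IH (fun a => h (lift ord0 a)) (fun a => dh _).
have e : (fun q => \sum_(a < m.+1) h a q) =
         fun q => h ord0 q + \sum_(a < m) h (lift ord0 a) q.
  by apply/funext => q; rewrite big_ord_recl.
rewrite e; split=> [|k].
  by rewrite /diff_in_chart readD//; apply: differentiableD => //; exact: dh.
rewrite big_ord_recl -d2 /pd /partial readD// deriveD//.
- by apply: diff_derivable; exact: dh.
- exact: diff_derivable.
Qed.

(* The invariant formula
   (L_X g)(Y, Z) = X(g(Y, Z)) - g([X, Y], Z) - g(Y, [X, Z]). *)
Lemma lie_invariant (X Y Z : idx A -> T -> 'rV[R]_n)
    (g : idx A -> T -> 'M[R]_n) i p :
  smooth_manifold -> tensor02 g ->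
  vector_field X -> vector_field Y -> vector_field Z -> dom i p ->
  tensor_eval (lie X g) Y Z i p =
    dir_deriv X i (tensor_eval g Y Z i) p
    - tensor_eval g (bracket X Y) Z i p - tensor_eval g Y (bracket X Z) i p.
Proof.
move=> [_ _ _ /(_ i)[_ inj _ _] _] [sg _] _ [sY _] [sZ _] ip.
have dS h : smooth_in_chart i h -> diff_in_chart i p h.
  by move=> /(_ 1)[+ _]; apply; exists p.
have dg a b : diff_in_chart i p (fun q => g i q a b) by exact/dS/sg.
have dY a : diff_in_chart i p (fun q => Y i q 0 a) by exact/dS/sY.
have dZ a : diff_in_chart i p (fun q => Z i q 0 a) by exact/dS/sZ.
have dYZ a b : diff_in_chart i p (fun q => Y i q 0 a * Z i q 0 b).
  exact: diffM.
have dT a b : diff_in_chart i p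
    (fun q => g i q a b * (Y i q 0 a * Z i q 0 b)) by exact: diffM.
have dTs a := diff_pd_sum inj ip (dT a).
have [_ dE] := diff_pd_sum inj ip (fun a => (dTs a).1).
have -> : dir_deriv X i (tensor_eval g Y Z i) p =
    \sum_a \sum_b (dir_deriv X i (fun q => g i q a b) p *
        (Y i p 0 a * Z i p 0 b)
      + g i p a b * (dir_deriv X i (fun q => Y i q 0 a) p * Z i p 0 b)
      + g i p a b * (Y i p 0 a * dir_deriv X i (fun q => Z i q 0 b) p)).
  rewrite /dir_deriv /tensor_eval.
  under eq_bigr => k _.
    rewrite dE mulr_sumr.
    under eq_bigr => a _.
      rewrite (dTs a).2 mulr_sumr.
      under eq_bigr => b _ do rewrite !pdM//.
      over.
    over.
  rewrite exchange_big; apply: eq_bigr => a _ /=.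
  rewrite exchange_big; apply: eq_bigr => b _ /=.
  rewrite !mulr_suml !mulr_sumr -!big_split /=; apply: eq_bigr => k _.
  by ring.
rewrite /tensor_eval.
have -> : \sum_a \sum_b g i p a b * (bracket X Y i p 0 a * Z i p 0 b) =
    \sum_a \sum_b (g i p a b * (dir_deriv X i (fun q => Y i q 0 a) p * Z i p 0 b)
      - (\sum_k g i p k b * pd i a (fun q => X i q 0 k) p) *
        (Y i p 0 a * Z i p 0 b)).
  transitivity (\sum_a \sum_b
       g i p a b * (dir_deriv X i (fun q => Y i q 0 a) p * Z i p 0 b) -
     \sum_a \sum_b
       g i p a b * (dir_deriv Y i (fun q => X i q 0 a) p * Z i p 0 b)).
    rewrite -sumrB; apply: eq_bigr => a _; rewrite -sumrB.
    by apply: eq_bigr => b _; rewrite /bracket mxE mulrBl mulrBr.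
  under [RHS]eq_bigr => a _ do rewrite sumrB.
  rewrite sumrB; congr (_ - _); rewrite exchange_big [RHS]exchange_big.
  apply: eq_bigr => b _ /=; under [RHS]eq_bigr => a _ do rewrite mulr_suml.
  rewrite exchange_big; apply: eq_bigr => a _ /=.
  rewrite /dir_deriv mulr_suml mulr_sumr; apply: eq_bigr => k _.
  by ring.
have -> : \sum_a \sum_b g i p a b * (Y i p 0 a * bracket X Z i p 0 b) =
    \sum_a \sum_b (g i p a b * (Y i p 0 a * dir_deriv X i (fun q => Z i q 0 b) p)
      - (\sum_k g i p a k * pd i b (fun q => X i q 0 k) p) *
        (Y i p 0 a * Z i p 0 b)).
  transitivity (\sum_a \sum_b
       g i p a b * (Y i p 0 a * dir_deriv X i (fun q => Z i q 0 b) p) -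
     \sum_a \sum_b
       g i p a b * (Y i p 0 a * dir_deriv Z i (fun q => X i q 0 b) p)).
    rewrite -sumrB; apply: eq_bigr => a _; rewrite -sumrB.
    by apply: eq_bigr => b _; rewrite /bracket mxE mulrBr mulrBr.
  under [RHS]eq_bigr => a _ do rewrite sumrB.
  rewrite sumrB; congr (_ - _).
  apply: eq_bigr => a _ /=; under [RHS]eq_bigr => b _ do rewrite mulr_suml.
  rewrite exchange_big; apply: eq_bigr => b _ /=.
  rewrite /dir_deriv !mulr_sumr; apply: eq_bigr => k _.
  by ring.
rewrite -!sumrB; apply: eq_bigr => a _; rewrite -!sumrB.
apply: eq_bigr => b _; rewrite /lie mxE; by ring.
Qed.

End Charts.

(* The product of the open interval I (with its global coordinate t) and M,
   with the product charts (t, p) |-> (t, coord i p). *)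
Definition interval_prod_atlas (R : realType) (I : set R) (T : topologicalType)
    (n : nat) (A : atlas R T n) : atlas R (I * T)%type (1 + n) :=
  @Atlas R (I * T)%type (1 + n) (idx A)
    (fun i => [set q | dom i q.2])
    (fun i q => row_mx (\val q.1)%:M (coord i q.2)).

Definition static_metric (R : realType) (I : set R) (T : topologicalType)
    (n : nat) (A : atlas R T n) (f : T -> R) (g : idx A -> T -> 'M[R]_n) :
    idx (interval_prod_atlas I A) -> (I * T)%type -> 'M[R]_(1 + n) :=
  fun i q => block_mx (- f q.2 ^+ 2)%:M 0 0 (g i q.2).
Arguments static_metric {R} I {T n A} f g.

(* u d/dt + zeta *)
Definition static_field (R : realType) (I : set R) (T : topologicalType)
    (n : nat) (A : atlas R T n) (u : R -> R) (zeta : idx A -> T -> 'rV[R]_n) :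
    idx (interval_prod_atlas I A) -> (I * T)%type -> 'rV[R]_(1 + n) :=
  fun i q => row_mx (u (\val q.1))%:M (zeta i q.2).
Arguments static_field {R} I {T n A} u zeta.

(* The real cube root, defined on the whole line. *)
Definition cbrt (R : realType) (x : R) : R := Num.sg x * `|x| `^ 3^-1.

(* Main.v *)
(* Because u depends on t only, and zeta and f on the point of M only, a field
   of the form phi dt^2 + G with G on M is mapped by the Lie derivative along
   u d/dt + zeta to (zetabar(phi) + 2 u' phi) dt^2 + L_zeta G, without cross
   terms.  Two applications to -f^2 dt^2 + g leave L_zeta L_zeta g = 0 and the
   dt^2 coefficient, in which phi = -2 (f zeta(f) + f^2 u') after the first
   step.  In case (1), phi is the constant -2 b and u' = 0.  In case (2),
   phi = -2 f^2 u' and the final coefficient is -2 f^2 (u u'' + 2 u'^2), which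
   vanishes when u^3 is affine. *)
Require Import Defs.
From mathcomp Require Import all_boot all_order all_algebra.
From mathcomp Require Import all_classical all_reals all_analysis.
From mathcomp Require Import ring.
(* After the imports above, [coord] would mean [vector.coord]. *)
Import Defs.
Set Implicit Arguments.
Unset Strict Implicit.
Unset Printing Implicit Defensive.
Import Order.TTheory GRing.Theory Num.Theory.
Import numFieldNormedType.Exports.
Local Open Scope classical_set_scope.
Local Open Scope ring_scope.

(** * Locality of differentials and directional derivatives *)

(** The first-order expansion at [x] depends only on the germ of the function, so the differential
    of [h] also expands [k]; uniqueness of the differential then identifies it with that of [k]. *)
Lemma near_eq_differentiable (R : numFieldType) (V W : normedModType R)
    (h k : V -> W) (x : V) :
  (\forall y \near x, h y = k y) -> differentiable h x -> differentiable k x.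
Proof.
move=> hk /diff_locallyP[cdh /eqaddoP dh].
have e : k \o shift x = cst (k x) + 'd h x +o_ 0 id.
  apply/eqaddoP => eps /dh; move: (hk); rewrite (near_shift 0) subr0.
  apply: filterS2 => y /= hky.
  by rewrite !fctE /= -hky -(nbhs_singleton hk).
by apply/diff_locallyP; rewrite (diff_unique cdh e).
Qed.

(** A directional derivative sees only the restriction to a line. The two lines may lie in different
    spaces, which is how partial derivatives in a product chart are compared with derivatives on a
    factor. *)
Lemma eq_derive_along (R : realType) (V V' W : normedModType R)
    (h : V -> W) (k : V' -> W) (x v : V) (y w : V') :
  (\forall s \near (0 : R), h (s *: v + x) = k (s *: w + y)) ->
  'D_v h x = 'D_w k y.
Proof.
move=> hk; rewrite /derive; congr (lim _).
(* At [s = 0] the hypothesis equates the base values in the two difference quotients. *)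
have := nbhs_singleton hk; rewrite !scale0r !add0r => hky.
rewrite eqEsubset; split; apply/near_eq_cvg/cvg_within;
  apply: filterS hk => s /= e.
  by rewrite e hky.
by rewrite e hky.
Qed.

Lemma eq_derive_line (R : realType) (V V' W : normedModType R)
    (h : V -> W) (k : V' -> W) (x v : V) (y w : V') :
  (forall s : R, h (s *: v + x) = k (s *: w + y)) -> 'D_v h x = 'D_w k y.
Proof.
by move=> hk; apply: eq_derive_along; apply: (@nearW _ (nbhs (0 : R))).
Qed.

Lemma open_near_line (R : realType) (V : normedModType R) (U : set V)
    (x v : V) : open U -> U x -> \forall s \near (0 : R), U (s *: v + x).
Proof.
move=> oU Ux.
apply: (@near0Z _ _ v [set y | U (y + x)]).
have : \forall y \near x, U y by exact: open_nbhs_nbhs.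
by rewrite (near_shift 0) subr0.
Qed.

(** * Functions of class C^m on subsets of R^n *)

Section Cdiff.
Context {R : realType}.

(** Openness turns equality on [U] into equality near each of its points, which passes to partial
    derivatives and so through the induction. *)
Lemma eq_Cdiff n m (U : set 'rV[R]_n) (h k : 'rV[R]_n -> R) : open U ->
  (forall x, U x -> h x = k x) -> Cdiff m U h -> Cdiff m U k.
Proof.
move=> oU; elim: m h k => //= m IH h k hk [dh Ch].
have nhk x : U x -> \forall y \near x, h y = k y.
  by move=> Ux; apply: (filterS hk); exact: open_nbhs_nbhs.
split=> [x Ux|l]; first exact: near_eq_differentiable (nhk x Ux) (dh x Ux).
by apply: IH (Ch l) => x Ux; apply: near_eq_derive; exact: nhk.
Qed.

Lemma Cdiff_cst n m (U : set 'rV[R]_n) (c : R) : Cdiff m U (cst c).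
Proof.
elim: m c => //= m IH c; split=> [x _|k]; first exact: differentiable_cst.
have -> : partial k (cst c) = cst 0 :> ('rV[R]_n -> R).
  by apply/funext => x; exact: derive_cst.
exact: IH.
Qed.

(** The only nonzero partial derivative is the one along [j], and it is again of this form, with w'
    for [w]; hence the induction with [w] generalised. *)
Lemma Cdiff_coord n m (U : set 'rV[R]_n) (I : set R) (j : 'I_n) (w : R -> R) :
  (forall x, U x -> I (x 0 j)) ->
  (forall l t, (l < m)%N -> I t -> derivable (derive1n l w) t 1) ->
  Cdiff m U (fun x => w (x 0 j)).
Proof.
move=> UI; elim: m w => //= m IH w dw; split=> [x Ux|k].
  apply: (@differentiable_comp _ _ _ _ (fun x : 'rV[R]_n => x 0 j) w).
    exact: differentiable_coord.
  by apply/derivable1_diffP; exact: (dw 0 _ _ (UI _ Ux)).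
have [->|kj] := eqVneq k j.
  have -> : partial j (fun x => w (x 0 j)) = fun x => w^`()%classic (x 0 j).
    apply/funext => x; rewrite derive1E; apply: eq_derive_line => s.
    by rewrite !mxE !eqxx.
  by apply: IH => l t lm It; rewrite -derive1Sn; exact: dw.
have -> : partial k (fun x => w (x 0 j)) = cst 0.
  apply/funext => x; rewrite -(derive_cst (w (x 0 j)) x (delta_mx 0 k)).
  apply: eq_derive_line => s.
  by rewrite !mxE eq_sym (negbTE kj) andbF mulr0 add0r.
exact: Cdiff_cst.
Qed.

(** Partial derivatives along the first block vanish, and those along the second are partial
    derivatives of [h] composed with the same projection. *)
Lemma Cdiff_rsubmx n1 n2 m (U : set 'rV[R]_(n1 + n2)) (V : set 'rV[R]_n2)
    (h : 'rV[R]_n2 -> R) :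
  (forall x, U x -> V (rsubmx x)) ->
  Cdiff m V h -> Cdiff m U (fun x => h (rsubmx x)).
Proof.
move=> UV; elim: m h => //= m IH h [dh Ch]; split=> [x Ux|k].
  apply: (@differentiable_comp _ _ _ _ rsubmx h).
    exact: differentiable_rsubmx.
  exact/dh/UV.
case: (split_ordP k) => l ->.
  have -> : partial (lshift n2 l) (fun x => h (rsubmx x)) = cst 0.
    apply/funext => x.
    rewrite -(derive_cst (h (rsubmx x)) x (delta_mx 0 (lshift n2 l))).
    apply: eq_derive_line => s.
    by rewrite linearP /= delta_mx_lshift row_mxKr scaler0 add0r.
  exact: Cdiff_cst.
have -> : partial (rshift n1 l) (fun x => h (rsubmx x)) =
    fun x => partial l h (rsubmx x).
  apply/funext => x; apply: eq_derive_line => s.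
  by rewrite linearP /= delta_mx_rshift row_mxKr.
exact: IH.
Qed.

End Cdiff.

(** * Functions read in a chart *)

Section Charts.
Context {R : realType} {T : topologicalType} {n : nat} (A : atlas R T n).
Implicit Types (i : idx A) (p : T).

Lemma eq_read i (h k : T -> R) :
  (forall p, dom i p -> h p = k p) -> read i h = read i k.
Proof.
move=> hk; apply/funext => x; congr (xget 0 _); apply/seteqP; split=> y /=.
  by case=> p [ip xp] <-; exists p => //; rewrite hk.
by case=> p [ip xp] <-; exists p => //; rewrite hk.
Qed.

Lemma eq_pd i k (h1 h2 : T -> R) :
  (forall p, dom i p -> h1 p = h2 p) -> pd i k h1 = pd i k h2.
Proof. by move=> e; rewrite /pd (eq_read e). Qed.

Lemma eq_dir_deriv (X : idx A -> T -> 'rV[R]_n) i (h1 h2 : T -> R) :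
  (forall p, dom i p -> h1 p = h2 p) -> dir_deriv X i h1 = dir_deriv X i h2.
Proof.
by move=> e; apply/funext => p; apply: eq_bigr => k _; rewrite (eq_pd k e).
Qed.

Lemma readN i (h : T -> R) : {in dom i &, injective (coord i)} ->
  read i (fun p => - h p) = - read i h.
Proof.
move=> inj; apply/funext => x; rewrite fctE.
have [[q iq <-]|Nx] := pselect ((coord i @` dom i) x); first by rewrite !readE.
by rewrite !read_out// oppr0.
Qed.

(** Meant for the coefficient -f^2 of dt^2 in the static metric. *)
Lemma diff_pdNX2 i p (h : T -> R) : {in dom i &, injective (coord i)} ->
  dom i p -> diff_in_chart i p h ->
  diff_in_chart i p (fun q => - h q ^+ 2) /\
  forall k, pd i k (fun q => - h q ^+ 2) p = - (2 * h p * pd i k h p).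
Proof.
move=> inj ip dh; have d2 := diffM inj dh dh; split=> [|k].
  by rewrite /diff_in_chart readN//; exact: differentiableN.
transitivity (- pd i k (fun q => h q * h q) p).
  by rewrite /pd /partial readN// deriveN//; exact: diff_derivable.
by rewrite pdM//; ring.
Qed.

End Charts.

(** * Product charts on I x M and derivatives of functions of one factor *)

Section Product.
Context {R : realType} {T : topologicalType} {n : nat} (A : atlas R T n).
Context (I : set R).
Hypothesis hA : smooth_manifold A.
Hypothesis I_open : open I.
Local Notation B := (interval_prod_atlas I A).
Implicit Types (i : idx A) (q : (I * T)%type) (p : T).

Let inj i : {in dom i &, injective (coord i)}.
Proof. by case: hA => _ _ _ /(_ i)[]. Qed.

Let open_coord i : open (coord i @` dom i).
Proof. by case: hA => _ _ _ /(_ i)[od _ _ + _]; apply. Qed.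

Let valI (t : I) : I (\val t). Proof. exact: set_valP. Qed.

Let near_valI (t : I) : \forall s \near (0 : R), I (s + \val t).
Proof.
have : \forall s \near \val t, I s by exact: open_nbhs_nbhs.
by rewrite (near_shift 0) subr0.
Qed.

Lemma prod_coordl i q a : coord (i : idx B) q 0 (lshift n a) = \val q.1.
Proof. by rewrite /= row_mxEl mxE ord1 eqxx. Qed.

Lemma prod_coordr i q k : coord (i : idx B) q 0 (rshift 1 k) = coord i q.2 0 k.
Proof. by rewrite /= row_mxEr. Qed.

Lemma rsubmx_prod_coord i q : rsubmx (coord (i : idx B) q) = coord i q.2.
Proof. by rewrite /= row_mxKr. Qed.

Lemma prod_coord_inj i :
  {in dom (i : idx B) &, injective (coord (i : idx B))}.
Proof.
move=> [t p] [t' p']; rewrite !inE /= => ip ip' /eq_row_mx[/eqP e1 e2].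
congr pair.
  by apply: val_inj; move: e1 => /eqP/matrixP/(_ 0 0); rewrite !mxE eqxx.
by apply: (inj (i := i)) => //; rewrite inE.
Qed.

Lemma prod_coordP i x : (coord (i : idx B) @` dom (i : idx B)) x <->
  I (x 0 (lshift n 0)) /\ (coord i @` dom i) (rsubmx x).
Proof.
split.
  case=> q iq <-; rewrite prod_coordl rsubmx_prod_coord.
  by split; [exact: valI | exists q.2].
case=> Ix [p ip px]; exists (SigSub (mem_set Ix), p) => //=.
rewrite px -[RHS]hsubmxK; congr row_mx.
by apply/matrixP => a b; rewrite !ord1 !mxE eqxx mulr1n.
Qed.

Lemma open_prod_coord i : open (coord (i : idx B) @` dom (i : idx B)).
Proof.
have -> : coord (i : idx B) @` dom (i : idx B) =
    (fun x : 'rV[R]_(1 + n) => x 0 (lshift n 0)) @^-1` I `&`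
    rsubmx @^-1` (coord i @` dom i).
  by apply/seteqP; split=> x /=; move/(prod_coordP i x).
apply: openI; apply: open_comp => //.
- by move=> x _; exact: coord_continuous.
- by move=> x _; exact: continuous_rsubmx.
Qed.

(** The reading agrees with [w] of the first coordinate on the image of the product chart, where
    [eq_Cdiff] transfers smoothness; off the image it is 0 by default. *)
Lemma Cdiff_fst i m (w : R -> R) :
  (forall l t, (l < m)%N -> I t -> derivable (derive1n l w) t 1) ->
  Cdiff m (coord (i : idx B) @` dom (i : idx B))
    (read (i : idx B) (fun q => w (\val q.1))).
Proof.
move=> dw; pose w' (x : 'rV[R]_(1 + n)) := w (x 0 (lshift n 0)).
apply: (@eq_Cdiff _ _ _ _ w' _ (@open_prod_coord i)); last first.
  apply: (Cdiff_coord (I := I) (j := lshift n 0)) dw => x.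
  by move=> /prod_coordP[].
move=> _ [q iq <-]; rewrite readE//; last exact: prod_coord_inj.
by rewrite /w' prod_coordl.
Qed.

Lemma Cdiff_snd i m (h : T -> R) :
  Cdiff m (coord i @` dom i) (read i h) ->
  Cdiff m (coord (i : idx B) @` dom (i : idx B))
    (read (i : idx B) (fun q => h q.2)).
Proof.
move=> dh; pose h' (x : 'rV[R]_(1 + n)) := read i h (rsubmx x).
apply: (@eq_Cdiff _ _ _ _ h' _ (@open_prod_coord i)); last first.
  by apply: Cdiff_rsubmx dh => x /prod_coordP[].
move=> _ [q iq <-]; rewrite readE//; last exact: prod_coord_inj.
by rewrite /h' rsubmx_prod_coord readE.
Qed.

Lemma diff_fst i q (w : R -> R) : dom i q.2 ->
  (forall t, I t -> derivable w t 1) ->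
  diff_in_chart (i : idx B) q (fun q => w (\val q.1)).
Proof.
move=> iq dw; have [d _] : Cdiff 1 (coord (i : idx B) @` dom (i : idx B))
    (read (i : idx B) (fun q => w (\val q.1))).
  by apply: Cdiff_fst => -[|//] t _; exact: dw.
by apply: d; exists q.
Qed.

(** The counterpart of [Cdiff_snd] at a single point, for functions known to be differentiable only
    there. *)
Lemma diff_snd i q (h : T -> R) : dom i q.2 ->
  diff_in_chart i q.2 h -> diff_in_chart (i : idx B) q (fun q => h q.2).
Proof.
move=> iq dh; pose h' (x : 'rV[R]_(1 + n)) := read i h (rsubmx x).
apply: (@near_eq_differentiable _ _ _ h'); last first.
  apply: (@differentiable_comp _ _ _ _ rsubmx (read i h)).
    exact: differentiable_rsubmx.
  by rewrite rsubmx_prod_coord.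
have : nbhs (coord (i : idx B) q) (coord (i : idx B) @` dom (i : idx B)).
  by apply: open_nbhs_nbhs; split; [exact: open_prod_coord | exists q].
apply: filterS => _ [q' iq' <-]; rewrite readE//; last exact: prod_coord_inj.
by rewrite /h' rsubmx_prod_coord readE.
Qed.

Lemma read_fst i (t : R) y (w : R -> R) : I t -> (coord i @` dom i) y ->
  read (i : idx B) (fun q => w (\val q.1)) (row_mx t%:M y) = w t.
Proof.
move=> It [p ip <-].
exact: (@readE _ _ _ B i (fun q => w (\val q.1)) (SigSub (mem_set It), p)
  (@prod_coord_inj i) ip).
Qed.

Lemma read_snd i (t : R) y (h : T -> R) : I t ->
  read (i : idx B) (fun q => h q.2) (row_mx t%:M y) = read i h y.
Proof.
move=> It; have [[p ip <-]|Ny] := pselect ((coord i @` dom i) y).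
  rewrite [RHS]readE//.
  exact: (@readE _ _ _ B i (fun q => h q.2) (SigSub (mem_set It), p)
    (@prod_coord_inj i) ip).
(* Off the chart image both readings take the default value 0, so the equality holds along entire
   lines in the M directions. *)
rewrite !read_out// => /prod_coordP[_]; by rewrite row_mxKr.
Qed.

Let moveL (s t : R) (y : 'rV[R]_n) (a : 'I_1) :
  s *: delta_mx 0 (lshift n a) + row_mx t%:M y = row_mx (s + t)%:M y.
Proof.
rewrite delta_mx_lshift scale_row_mx add_row_mx scaler0 add0r; congr row_mx.
by apply/matrixP => b c; rewrite !ord1 !mxE !eqxx /= !mulr1n mulr1.
Qed.

Let moveR (s t : R) (y : 'rV[R]_n) (k : 'I_n) :
  s *: delta_mx 0 (rshift 1 k) + row_mx t%:M y =
  row_mx t%:M (s *: delta_mx 0 k + y).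
Proof. by rewrite delta_mx_rshift scale_row_mx add_row_mx scaler0 add0r. Qed.

Lemma pd_fst_l i q a (w : R -> R) : dom i q.2 ->
  pd (i : idx B) (lshift n a) (fun q => w (\val q.1)) q =
  w^`()%classic (\val q.1).
Proof.
move=> iq; rewrite derive1E; apply: eq_derive_along.
(* Since [I] is open, a small move in the t direction stays in the chart image. *)
apply: filterS (near_valI q.1) => s Is.
by rewrite moveL read_fst /GRing.scale /= ?mulr1//; exists q.2.
Qed.

Lemma pd_fst_r i q k (w : R -> R) : dom i q.2 ->
  pd (i : idx B) (rshift 1 k) (fun q => w (\val q.1)) q = 0.
Proof.
move=> iq.
(* Zero becomes the derivative of a constant, so that both sides can be compared along a line. *)
rewrite -[RHS](derive_cst (w (\val q.1)) (coord i q.2) (delta_mx 0 k)).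
apply: eq_derive_along.
have Cq : (coord i @` dom i) (coord i q.2) by exists q.2.
apply: filterS (open_near_line (delta_mx 0 k) (@open_coord i) Cq) => s Cs.
by rewrite moveR read_fst.
Qed.

Lemma pd_snd_l i q a (h : T -> R) :
  pd (i : idx B) (lshift n a) (fun q => h q.2) q = 0.
Proof.
rewrite -[RHS](derive_cst (read i h (coord i q.2)) (\val q.1) 1).
apply: eq_derive_along.
apply: filterS (near_valI q.1) => s Is.
by rewrite moveL read_snd.
Qed.

Lemma pd_snd_r i q k (h : T -> R) :
  pd (i : idx B) (rshift 1 k) (fun q => h q.2) q = pd i k h q.2.
Proof.
apply: eq_derive_line => s.
by rewrite moveR read_snd.
Qed.

(** A change of product charts fixes t and acts on the M coordinates independently of t. *)
Lemma jac_prod i (j : idx A) q : dom i q.2 ->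
  jac (i : idx B) (j : idx B) q = block_mx 1%:M 0 0 (jac i j q.2).
Proof.
move=> iq; apply/matrixP => k l; rewrite mxE.
have eL b : (fun q => coord (j : idx B) q 0 (lshift n b)) =
    fun q : I * T => id (\val q.1).
  by apply/funext => q'; rewrite prod_coordl.
have eR b : (fun q => coord (j : idx B) q 0 (rshift 1 b)) =
    fun q : I * T => (fun p => coord j p 0 b) q.2.
  by apply/funext => q'; rewrite prod_coordr.
case: (split_ordP k) => a ->; case: (split_ordP l) => b ->.
- by rewrite block_mxEul eL (pd_fst_l _ id)// derive1E derive_id !ord1 mxE.
- by rewrite block_mxEur eR (pd_snd_l _ _ _ (fun p => coord j p 0 b)) mxE.
- by rewrite block_mxEdl eL (pd_fst_r _ id)// mxE.
- by rewrite block_mxEdr eR (pd_snd_r _ _ _ (fun p => coord j p 0 b)) mxE.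
Qed.

(** * The field u d/dt + zeta and its Lie derivative *)

Section Field.
Context (u : R -> R) (zeta : idx A -> T -> 'rV[R]_n).
Local Notation Z := (static_field I u zeta).

Lemma vector_field_static : smooth_on_line I u -> vector_field zeta ->
  vector_field Z.
Proof.
move=> su [sz tz]; split=> [i k m|i j q iq jq]; last first.
  rewrite (jac_prod _ iq) /static_field mul_row_block mulmx1 !mulmx0.
  by rewrite addr0 add0r (tz i j).
case: (split_ordP k) => a ->.
  have -> : (fun q => Z i q 0 (lshift n a)) = fun q => u (\val q.1).
    by apply/funext => q; rewrite row_mxEl mxE ord1 eqxx.
  by apply: Cdiff_fst => l t _; exact: su.
have -> : (fun q => Z i q 0 (rshift 1 a)) =
    fun q => (fun p => zeta i p 0 a) q.2.
  by apply/funext => q; rewrite row_mxEr.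
exact: (@Cdiff_snd i m (fun p => zeta i p 0 a) (sz i a m)).
Qed.

Lemma dir_deriv_static i h q : dir_deriv Z i h q =
  u (\val q.1) * pd (i : idx B) (lshift n 0) h q +
  \sum_k zeta i q.2 0 k * pd (i : idx B) (rshift 1 k) h q.
Proof.
rewrite /dir_deriv big_split_ord big_ord1 /= row_mxEl mxE eqxx; congr (_ + _).
by apply: eq_bigr => k _; rewrite row_mxEr.
Qed.

Lemma dir_deriv_fst i q (w : R -> R) : dom i q.2 ->
  dir_deriv Z i (fun q => w (\val q.1)) q =
  u (\val q.1) * w^`()%classic (\val q.1).
Proof.
move=> iq; rewrite dir_deriv_static pd_fst_l// big1 ?addr0// => k _.
by rewrite pd_fst_r// mulr0.
Qed.

Lemma dir_deriv_snd i q (h : T -> R) :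
  dir_deriv Z i (fun q => h q.2) q = dir_deriv zeta i h q.2.
Proof.
rewrite dir_deriv_static pd_snd_l mulr0 add0r.
by apply: eq_bigr => k _; rewrite pd_snd_r.
Qed.

(** The Leibniz rule for separated variables, the form that the dt^2 coefficient takes in case
    (2). *)
Lemma dir_deriv_fst_snd i q (w : R -> R) (h : T -> R) : dom i q.2 ->
  (forall t, I t -> derivable w t 1) -> diff_in_chart i q.2 h ->
  dir_deriv Z i (fun q => w (\val q.1) * h q.2) q =
  u (\val q.1) * w^`()%classic (\val q.1) * h q.2 +
  w (\val q.1) * dir_deriv zeta i h q.2.
Proof.
move=> iq dw dh; have bw := diff_fst iq dw; have bh := diff_snd iq dh.
rewrite -(dir_deriv_fst w iq) -(dir_deriv_snd i q h) /dir_deriv.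
rewrite mulr_suml mulr_sumr -big_split; apply: eq_bigr => k _ /=.
rewrite (pdM _ (@prod_coord_inj i) iq bw bh); ring.
Qed.

(** The block form is assumed over the chart [i] only and [phi] is arbitrary, so that the lemma
    applies first to the metric and then to its Lie derivative. *)
Lemma lie_static (G' : idx B -> (I * T)%type -> 'M[R]_(1 + n))
    (G : idx A -> T -> 'M[R]_n) (phi : I * T -> R) i q :
  (forall q, dom i q.2 -> G' i q = block_mx (phi q)%:M 0 0 (G i q.2)) ->
  dom i q.2 ->
  lie Z G' i q =
  block_mx (dir_deriv Z i phi q + 2 * u^`()%classic (\val q.1) * phi q)%:M 0 0
           (lie zeta G i q.2).
Proof.
move=> eG iq.
have eul q' a b : dom i q'.2 -> G' i q' (lshift n a) (lshift n b) = phi q'.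
  by move=> ?; rewrite eG// block_mxEul mxE !ord1 eqxx.
have eur q' a b : dom i q'.2 -> G' i q' (lshift n a) (rshift 1 b) = 0.
  by move=> ?; rewrite eG// block_mxEur mxE.
have edl q' a b : dom i q'.2 -> G' i q' (rshift 1 a) (lshift n b) = 0.
  by move=> ?; rewrite eG// block_mxEdl mxE.
have edr q' a b : dom i q'.2 ->
    G' i q' (rshift 1 a) (rshift 1 b) = G i q'.2 a b.
  by move=> ?; rewrite eG// block_mxEdr.
have eZl a : (fun q => Z i q 0 (lshift n a)) = fun q => u (\val q.1).
  by apply/funext => q'; rewrite row_mxEl mxE ord1 eqxx.
have eZr a : (fun q => Z i q 0 (rshift 1 a)) =
    fun q => (fun p => zeta i p 0 a) q.2.
  by apply/funext => q'; rewrite row_mxEr.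
have dir0 (h : I * T -> R) : (forall q, dom i q.2 -> h q = 0) ->
    dir_deriv Z i h q = 0.
  move=> h0; rewrite (@eq_dir_deriv _ _ _ B Z i h (fun q => cst 0 (\val q.1)))//.
  by rewrite dir_deriv_fst// derive1_cst mulr0.
(* Each sum over the 1 + n directions is split into its t term and its M terms. *)
have lieE k l : lie Z G' i q k l =
    dir_deriv Z i (fun q => G' i q k l) q
    + (G' i q (lshift n 0) l * pd (i : idx B) k (fun q => u (\val q.1)) q
       + \sum_c G' i q (rshift 1 c) l *
           pd (i : idx B) k (fun q => (fun p => zeta i p 0 c) q.2) q)
    + (G' i q k (lshift n 0) * pd (i : idx B) l (fun q => u (\val q.1)) q
       + \sum_c G' i q k (rshift 1 c) *
           pd (i : idx B) l (fun q => (fun p => zeta i p 0 c) q.2) q).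
  rewrite mxE; congr (_ + _ + _); rewrite [LHS]big_split_ord /=;
    (congr (_ + _); [by rewrite big_ord1 eZl|]);
    by apply: eq_bigr => c _; rewrite eZr.
have sum0 m (F H : 'I_m -> R) : (forall c, F c = 0) ->
    \sum_c F c * H c = 0.
  by move=> F0; apply: big1 => c _; rewrite F0 mul0r.
have sum0r m (F H : 'I_m -> R) : (forall c, H c = 0) ->
    \sum_c F c * H c = 0.
  by move=> H0; apply: big1 => c _; rewrite H0 mulr0.
(* Along d/dt only [u] varies; along the M directions ([sumR]) only the components of [zeta] do. *)
have sumL (F : 'I_(1 + n) -> R) a :
    F (lshift n 0) * pd (i : idx B) (lshift n a) (fun q => u (\val q.1)) q
    + \sum_c F (rshift 1 c) *
        pd (i : idx B) (lshift n a) (fun q => (fun p => zeta i p 0 c) q.2) q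
    = F (lshift n 0) * u^`()%classic (\val q.1).
  rewrite (pd_fst_l a u iq) sum0r ?addr0// => c.
  exact: (pd_snd_l i q a (fun p => zeta i p 0 c)).
have sumR (F : 'I_(1 + n) -> R) a :
    F (lshift n 0) * pd (i : idx B) (rshift 1 a) (fun q => u (\val q.1)) q
    + \sum_c F (rshift 1 c) *
        pd (i : idx B) (rshift 1 a) (fun q => (fun p => zeta i p 0 c) q.2) q
    = \sum_c F (rshift 1 c) * pd i a (fun p => zeta i p 0 c) q.2.
  rewrite (pd_fst_r a u iq) mulr0 add0r; apply: eq_bigr => c _; congr (_ * _).
  exact: (pd_snd_r i q a (fun p => zeta i p 0 c)).
apply/matrixP => k l; apply: (etrans (lieE k l)).
case: (split_ordP k) => a ->; case: (split_ordP l) => b ->.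
(* Each of the two sums contributes u' phi, whence the factor 2. *)
- apply: (etrans (congr2 +%R (congr2 +%R erefl (sumL (G' i q ^~ _) a))
                             (sumL (G' i q _) b))).
  rewrite block_mxEul !(eul q _ _ iq) mxE !ord1 eqxx mulr1n.
  rewrite (eq_dir_deriv (A := B) Z (h2 := phi)); last by move=> q'; exact: eul.
  by ring.
(* In a mixed block every surviving term contains a mixed entry of [G'] or its derivative, hence
   vanishes. *)
- apply: (etrans (congr2 +%R (congr2 +%R erefl (sumL (G' i q ^~ _) a))
                             (sumR (G' i q _) b))).
  rewrite block_mxEur mxE (eur q _ _ iq) mul0r addr0.
  rewrite [X in _ + X]sum0 ?addr0; first by apply: dir0 => q'; exact: eur.
  by move=> c; exact: eur.
- apply: (etrans (congr2 +%R (congr2 +%R erefl (sumR (G' i q ^~ _) a))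
                             (sumL (G' i q _) b))).
  rewrite block_mxEdl mxE (edl q _ _ iq) mul0r addr0.
  rewrite [X in _ + X]sum0 ?addr0; first by apply: dir0 => q'; exact: edl.
  by move=> c; exact: edl.
- apply: (etrans (congr2 +%R (congr2 +%R erefl (sumR (G' i q ^~ _) a))
                             (sumR (G' i q _) b))).
  rewrite block_mxEdr mxE.
  rewrite (eq_dir_deriv (A := B) Z (h2 := fun q => (fun p => G i p a b) q.2));
    last by move=> q'; exact: edr.
  rewrite (dir_deriv_snd i q (fun p => G i p a b)).
  by congr (_ + _ + _); apply: eq_bigr => c _; rewrite (edr q _ _ iq).
Qed.

End Field.
End Product.

(** * The differential equation of the cube root of an affine function *)

Lemma cbrtX3 (R : realType) (x : R) : cbrt x ^+ 3 = x.
Proof.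
rewrite /cbrt exprMn -(powR_mulrn 3 (powR_ge0 _ _)) -powRrM mulVf ?powRr1//.
by rewrite exprS sqr_sg; have [->|x0] := eqVneq x 0;
  rewrite ?normr0 ?mulr0// mulr1 -numEsg.
Qed.

(* Differentiating [u ^+ 3 = r t + s] twice gives [u * (u u'' + 2 u'^2) = 0].
   Where [u] vanishes, one differentiation gives [r = 0], hence [u = 0] on I. *)
Lemma cbrt_affine_ode (R : realType) (I : set R) (u : R -> R) (r s : R) :
  open I -> smooth_on_line I u ->
  (forall t, I t -> u t = cbrt (r * t + s)) ->
  forall t, I t ->
    u t * u^`()^`()%classic t + 2 * u^`()%classic t ^+ 2 = 0.
Proof.
move=> oI su eu.
have u3 t : I t -> u t ^+ 3 = r * t + s by move=> It; rewrite eu// cbrtX3.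
have near_I t (P : R -> Prop) : I t -> (forall t, I t -> P t) ->
    \forall x \near t, P x.
  by move=> It IP; apply: (filterS IP); exact: open_nbhs_nbhs.
have d0 t : I t -> is_derive t 1 u (u^`()%classic t).
  by move=> It; rewrite derive1E; apply/derivableP; exact: (su 0).
have d1 t : I t -> is_derive t 1 u^`()%classic (u^`()^`()%classic t).
  move=> It; rewrite [X in is_derive _ _ _ X]derive1E.
  by apply/derivableP; exact: (su 1).
have e1 t : I t -> 3 * u t ^+ 2 * u^`()%classic t = r.
  move=> It; have ? := d0 t It.
  have : 'D_1 (u ^+ 3) t = 'D_1 (fun t => r * t + s) t.
    by apply/near_eq_derive/near_I => // x; exact: u3.
  by rewrite !derive_val /GRing.scale /= => ->; ring.
move=> t It; have ? := d0 t It; have ? := d1 t It.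
have [ut0|ut0] := eqVneq (u t) 0.
  have r0 : r = 0 by rewrite -(e1 t It) ut0; ring.
  have s0 : s = 0 by rewrite -[LHS]add0r -(mul0r t) -{1}r0 -u3// ut0; ring.
  (* With r = s = 0, [u] vanishes on all of [I], so u'(t) = 0; the term with u'' is killed by its
     factor u(t) = 0. *)
  have : 'D_1 u t = 'D_1 (cst 0) t.
    apply/near_eq_derive/near_I => // x Ix; apply/eqP.
    by have := expf_eq0 (u x) 3; rewrite u3// r0 s0 mul0r add0r eqxx /= => <-.
  by rewrite derive_cst -derive1E ut0 => ->; ring.
(* The constant comes from [e1], that is 3 u^2 u' = r. The derivative of u^2 u' is u(t) times the
   required expression, and u(t) is nonzero here. *)
have : 'D_1 (u ^+ 2 * u^`()%classic) t = 'D_1 (cst (r / 3)) t.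
  apply/near_eq_derive/near_I => // x Ix.
  by rewrite !fctE -(e1 x Ix); field.
rewrite derive_cst deriveM; last 2 first.
- exact/derivableX/ex_derive.
- exact: ex_derive.
rewrite deriveX; last exact: ex_derive.
rewrite -!derive1E /GRing.scale /= => e2; apply: (mulfI ut0).
by rewrite mulr0 -[RHS]e2 !fctE; ring.
Qed.

(** * The two cases of the theorem *)

Theorem theorem7 (R : realType) (n : nat) (M : topologicalType)
    (A : atlas R M n) (hM : smooth_manifold A)
    (g : idx A -> M -> 'M[R]_n) (hg : riemannian_metric g)
    (f : M -> R) (f_gt0 : forall p, 0 < f p) (f_smooth : smooth_function A f)
    (I : set R) (I_open : open I) (I_conn : connected I)
    (u : R -> R) (u_smooth : smooth_on_line I u)
    (zeta : idx A -> M -> 'rV[R]_n) (hzeta : vector_field zeta) :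
  (exists a b : R,
     [/\ two_killing g zeta,
         forall t, I t -> u t = a &
         forall i p, dom i p -> f p * dir_deriv zeta i f p = b])
  \/
  (exists r s : R,
     [/\ two_killing g zeta,
         forall t, I t -> u t = cbrt (r * t + s) &
         forall i p, dom i p -> dir_deriv zeta i f p = 0]) ->
  two_killing (static_metric I f g) (static_field I u zeta).
Proof.
move=> hyp; split; first exact: vector_field_static.
set Z := static_field I u zeta.
(* The product atlas has the same indices as [A]; [i] is retyped accordingly. *)
suff lie2 (i : idx A) q : dom i q.2 -> lie Z (lie Z (static_metric I f g)) i q = 0.
  by move=> i q; exact: lie2.
move=> iq.
have inj : {in dom i &, injective (coord i)} by case: hM => _ _ _ /(_ i)[].
have df p : dom i p -> diff_in_chart i p f.
  by move=> ip; have [d _] := f_smooth i 1; apply: d; exists p.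
pose F2 p := - f p ^+ 2; pose u1 := u^`()%classic.
have dF2 p ip := diff_pdNX2 inj ip (df p ip).
have zF2 p : dom i p ->
    dir_deriv zeta i F2 p = - (2 * (f p * dir_deriv zeta i f p)).
  move=> ip; rewrite /dir_deriv !mulr_sumr -sumrN; apply: eq_bigr => k _.
  by rewrite (dF2 p ip).2; ring.
(* The dt^2 coefficient of the first Lie derivative. *)
pose phi (q : I * M) := dir_deriv zeta i F2 q.2 + 2 * u1 (\val q.1) * F2 q.2.
have L1 q' : dom i q'.2 -> lie Z (static_metric I f g) i q' =
    block_mx (phi q')%:M 0 0 (lie zeta g i q'.2).
  move=> iq'.
  rewrite (@lie_static _ _ _ _ _ hM I_open u zeta _ g (fun q => F2 q.2))//.
  by rewrite (dir_deriv_snd hM I_open).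
rewrite (@lie_static _ _ _ _ _ hM I_open u zeta _ (lie zeta g) phi i q L1 iq).
have k2 : lie zeta (lie zeta g) i q.2 = 0.
  by case: hyp => -[? [? [[_ k2] _ _]]]; exact: k2.
(* The M block vanishes by [k2] in both cases; only the dt^2 coefficient remains. *)
suff e : dir_deriv Z i phi q + 2 * u1 (\val q.1) * phi q = 0.
  by rewrite k2 e raddf0 block_mx_const.
case: hyp => -[a [b [_ ua zf]]].
  have u10 t : I t -> u1 t = 0.
    move=> It; rewrite /u1 derive1E -(derive_cst a t 1); apply: near_eq_derive.
    by apply: (filterS ua); exact: open_nbhs_nbhs.
  (* The constant value of [phi] over the chart is presented as a function of t, so that
     [dir_deriv_fst] differentiates it. *)
  rewrite (@eq_dir_deriv _ _ _ _ Z i phi (fun q => cst (- (2 * b)) (\val q.1))).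
    rewrite (dir_deriv_fst hM I_open)// derive1_cst u10; last exact: set_valP.
    by ring.
  move=> q' iq'; rewrite /phi zF2// zf// u10; last exact: set_valP.
  by rewrite /=; ring.
(* As zeta(f) = 0, zeta(-f^2) drops out and [phi] separates into a function of t times a function on
   M. *)
have phiE q' : dom i q'.2 -> phi q' = (fun t => 2 * u1 t) (\val q'.1) * F2 q'.2.
  by move=> iq'; rewrite /phi zF2// zf//; ring.
have du1 t : I t -> derivable u1 t 1 by exact: (u_smooth 1).
have d2u1 t : I t -> derivable (fun t => 2 * u1 t) t 1.
  by move=> It; apply: derivableM; [exact: derivable_cst | exact: du1].
rewrite (eq_dir_deriv Z phiE) (dir_deriv_fst_snd hM I_open _ _ iq d2u1) ?phiE//;
  last first.
  by case: (dF2 _ iq).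
have It : I (\val q.1) := set_valP _.
rewrite zF2// zf// derive1Ml; last exact: du1.
have ode := cbrt_affine_ode I_open u_smooth ua It.
(* Differentiating 2 u' gives 2 u u'' and the term 2 u' phi gives 4 u'^2, both times -f^2. *)
transitivity (2 * F2 q.2 * (u (\val q.1) * u^`()^`()%classic (\val q.1) +
   2 * u^`()%classic (\val q.1) ^+ 2)); first by rewrite /u1; ring.
by rewrite ode mulr0.
Qed.
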